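(* Let $p$ be a prime and let $G$ be a non-abelian $p$-group with cyclic center $Z(G)$. Then there exist $z \in Z(G)$, $y \in Z_1(G)$ and $x \in G$ as well as an integer $r\ge 1$ such that the following hold: (a) $z = [x,y]$, and $\langle z\rangle$ is a subgroup of $Z(G)$ with $\langle z \rangle = [G,y] \cong \mathbb{Z}_{p^r}$. (b) $A = \langle y, Z(G)\rangle$ is an abelian normal subgroup of $G$ with $A/Z(G) = \langle yZ(G)\rangle \cong \mathbb{Z}_{p^r}$. (c) Define $G_0 = \{w \in G : [w,y] = e_G\}$. Then $G_0$ is a normal subgroup of $G$ with $G/G_0 = \langle xG_0\rangle\cong\mathbb{Z}_{p^r}$, and $A$ is a central subgroup of $G_0$.
   Context: A $p$-group is a finite group of order $p^s$ with $s>0$, $p$ prime. Notation: $[w,y] = w^{-1}y^{-1}wy$; $Z(G)$ is the center of $G$; $Z_1(G) = \{y\in G : yZ(G)\in Z(G/Z(G))\}$; $[G,y] = \{[w,y]: w \in G\}$; $\mathbb{Z}_n=\mathbb{Z}/n\mathbb{Z}$; $e_G$ is the identity of $G$; $\langle y, Z(G)\rangle$ is the subgroup generated by $y$ and $Z(G)$. *)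

(* Defs.v *)
From mathcomp Require Import all_boot all_fingroup all_algebra all_solvable.
Set Implicit Arguments.
Unset Strict Implicit.
Unset Printing Implicit Defensive.

Local Open Scope group_scope.

(* [~ w, y] is w^-1 * y^-1 * w * y. *)

Definition Z1 (gT : finGroupType) (G : {set gT}) : {set gT} :=
  [set y in G | coset 'Z(G) y \in 'Z(G / 'Z(G))].

(* The set of commutators itself, not the subgroup [~: G, [set y]] that it
   generates. *)
Definition commutators_with (gT : finGroupType) (G : {set gT}) (y : gT) :
    {set gT} :=
  [set [~ w, y] | w in G].

(* A bare set, so that being a subgroup remains a claim to be proved. *)
Definition commuting_with (gT : finGroupType) (G : {set gT}) (y : gT) :
    {set gT} :=
  [set w in G | [~ w, y] == 1].

(* Main.v *)
Require Import Defs.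
From mathcomp Require Import all_boot all_fingroup all_algebra all_solvable.

Local Open Scope group_scope.

(** Any [y] in [Z1 G] outside the center works.  Commutators with [y] are
central, so [w |-> [~ w, y]] is a morphism from [G] to the cyclic group
['Z(G)]; its kernel is [G0] and its image is cyclic, generated by some
[z = [~ x, y]].  This gives (a) and (c).  For (b), [[~ w, y ^+ k]] equals
[[~ w, y] ^+ k], so [y ^+ k] is central exactly when [z ^+ k = 1], and the
coset of [y] has the same order as [z]. *)

Section CommutatorMorphism.

Variables (gT : finGroupType) (G : {group gT}).

(** A group whose quotient by its center is cyclic is abelian, so [G / 'Z(G)] is nontrivial; being a
    [p]-group, it has a nontrivial central element, and [y] is a lift of one. *)
Lemma exists_noncentral_Z1 (p : nat) :
  p.-group G -> ~~ abelian G -> exists2 y, y \in Z1 G & y \notin 'Z(G).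
Proof.
move=> pG nabG.
have ntGZ : G / 'Z(G) != 1.
  apply: contra nabG => /eqP GZ1; apply: cyclic_center_factor_abelian.
  by rewrite GZ1 cyclic1.
have : 'Z(G / 'Z(G)) != 1.
  by rewrite center_nil_eq1 // (pgroup_nil (quotient_pgroup _ pG)).
case/trivgPn=> u Zu ntu.
have /morphimP[y Ny Gy def_u] := subsetP (center_sub _) u Zu.
exists y; first by rewrite inE Gy -def_u.
by apply: contraNN ntu => Zy; rewrite def_u; apply/eqP/coset_id.
Qed.

Variable y : gT.
Hypothesis Z1y : y \in Z1 G.

Lemma mem_Z1 : y \in G.
Proof. by move: Z1y; rewrite inE => /andP[]. Qed.

Lemma commg_Z1_center w : w \in G -> [~ w, y] \in 'Z(G).
Proof.
move=> Gw; have nZG := normal_norm (center_normal G).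
have [Nw Ny] := (subsetP nZG w Gw, subsetP nZG y mem_Z1).
apply: coset_idr; first exact: groupR.
rewrite morphR //; apply/eqP/commgP.
move: Z1y; rewrite inE => /andP[_ /centerP[_ cy]].
by apply/commute_sym/cy; rewrite mem_quotient.
Qed.

(** In general [[~ v * w, y] = [~ v, y] ^ w * [~ w, y]]; the conjugation by [w] disappears because
    [[~ v, y]] is central. *)
Lemma commg_Z1_morph : {in G &, {morph commg^~ y : v w / v * w}}.
Proof.
move=> v w Gv Gw /=; rewrite commMgJ; congr (_ * _).
have /centerP[_ cv] := commg_Z1_center v Gv.
by rewrite conjgE (cv w Gw) mulKg.
Qed.

Definition commg_Z1_morphism := Morphism commg_Z1_morph.

(** Lets the bare set inherit the group structure and normality of a kernel. *)
Lemma ker_commg_Z1 : 'ker commg_Z1_morphism = commuting_with G y.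
Proof. by apply/setP=> w; rewrite !inE. Qed.

Lemma im_commg_Z1 : commg_Z1_morphism @* G = commutators_with G y.
Proof. by rewrite morphimEdom. Qed.

Lemma expg_Z1_center (x : gT) k : x \in G ->
    <[[~ x, y]]> = commutators_with G y ->
  (y ^+ k \in 'Z(G)) = ([~ x, y] ^+ k == 1).
Proof.
move=> Gx genx.
have commXy w : w \in G -> [~ w, y ^+ k] = [~ w, y] ^+ k.
  move=> Gw; apply/commgX/commute_sym.
  by have /centerP[_ cw] := commg_Z1_center w Gw; apply/cw/mem_Z1.
apply/idP/idP=> [/centerP[_ cyk] | /eqP xk1].
  by rewrite -commXy //; apply/commgP/commute_sym/cyk.
apply/centerP; split=> [|w Gw]; first by rewrite groupX ?mem_Z1.
apply/commute_sym/commgP; rewrite commXy //.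
(* Every commutator with [y] is a power of [[~ x, y]], so an exponent that kills [[~ x, y]] kills
   them all. *)
have : [~ w, y] \in <[[~ x, y]]> by rewrite genx; apply/imsetP; exists w.
by case/cycleP=> i ->; rewrite -expgM mulnC expgM xk1 expg1n.
Qed.

End CommutatorMorphism.

Lemma isog_cycle_Zp (gT : finGroupType) (a : gT) n :
  #[a] = n -> <[a]> \isog Zp n.
Proof. by move <-; rewrite isog_sym Zp_isog. Qed.

Theorem lemma22 (p : nat) (gT : finGroupType) (G : {group gT})
    (p_prime : prime p) (pG : p.-group G) (nabG : ~~ abelian G)
    (cycZ : cyclic 'Z(G)) :
  exists (z y x : gT) (r : nat),
    [/\ z \in 'Z(G), y \in Z1 G, x \in G & (1 <= r)%N] /\
    let A := <<y |: 'Z(G)>> in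
    let G0 := commuting_with G y in
    [/\ (* (a) *)
        [/\ z = [~ x, y], <[z]> \subset 'Z(G),
            <[z]> = commutators_with G y & <[z]> \isog Zp (p ^ r)%N],
        (* (b) *)
        [/\ abelian A, A <| G, A / 'Z(G) = <[coset 'Z(G) y]>
          & A / 'Z(G) \isog Zp (p ^ r)%N]
      & (* (c) *)
        [/\ group_set G0, G0 <| G, G / G0 = <[coset G0 x]>,
            G / G0 \isog Zp (p ^ r)%N & A \subset 'Z(G0)]].
Proof.
have [y Z1y notZy] := exists_noncentral_Z1 _ G p pG nabG.
have Gy := mem_Z1 _ _ _ Z1y.
pose f := commg_Z1_morphism gT G y Z1y.
have sfZ : f @* G \subset 'Z(G).
  by apply/subsetP=> _ /morphimP[w _ Gw ->]; apply: commg_Z1_center.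
have [z def_fG] := cyclicP (cyclicS sfZ cycZ).
have fGz : z \in f @* G by rewrite def_fG cycle_id.
have Zz := subsetP sfZ z fGz.
have /morphimP[x _ Gx def_z] := fGz; rewrite /= in def_z.
have genz : <[z]> = commutators_with G y by rewrite -(im_commg_Z1 _ _ _ Z1y).
have expyZ k : (y ^+ k \in 'Z(G)) = (z ^+ k == 1).
  by rewrite def_z; apply: expg_Z1_center; rewrite -?def_z.
have pz : p.-elt z.
  by apply: mem_p_elt pG _; apply: (subsetP (center_sub G)).
have [r oz] := p_natP pz.
(* If [r = 0] then [z = 1], and [expyZ] at exponent 1 would make [y] central. *)
have r_gt0 : (0 < r)%N.
  case: r oz => // /eqP; rewrite expn0 order_eq1 => z1.
  by case/negP: notZy; rewrite -[y]expg1 expyZ expg1.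
have nZG := normal_norm (center_normal G).
have Ny := subsetP nZG y Gy.
have oy : #[coset 'Z(G) y] = (p ^ r)%N.
  (* The same exponents kill [z] and the coset of [y], so their orders divide each other. *)
  have eq1 k : (coset 'Z(G) y ^+ k == 1) = (z ^+ k == 1).
    rewrite -expyZ -morphX //; apply/eqP/idP=> [|/coset_id //].
    by apply: coset_idr; rewrite groupX.
  apply/eqP; rewrite -oz eqn_dvd !order_dvdn eq1 expg_order eqxx /=.
  by rewrite -eq1 expg_order.
have AE : <<y |: 'Z(G)>> = <[y]> <*> 'Z(G) by rewrite joing_idl.
have AZ : <<y |: 'Z(G)>> / 'Z(G) = <[coset 'Z(G) y]>.
  by rewrite AE quotientYidr ?cycle_subG // quotient_cycle.
have cZA : 'Z(G) \subset 'C(<[y]>).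
  by rewrite (subset_trans (subsetIr _ _)) // centS ?cycle_subG.
have abA : abelian <<y |: 'Z(G)>>.
  by rewrite AE abelianY cycle_abelian center_abelian cZA.
have sAG : <<y |: 'Z(G)>> \subset G.
  by rewrite gen_subG subUset sub1set Gy center_sub.
exists z, y, x, r; split=> //; split; split=> //.
- by rewrite cycle_subG.
- exact: isog_cycle_Zp.
(* Normality is pulled back from [G / 'Z(G)], where the image of [A] is generated by a central
   element. *)
- rewrite -[<<_>>](quotientGK (H := 'Z(G))%G) /=; last first.
    rewrite /normal (subset_trans sAG nZG) andbT.
    exact: subset_trans (subsetUr _ _) (subset_gen _).
  rewrite -[X in _ <| X](quotientGK (center_normal G)) cosetpre_normal.
  apply: sub_center_normal; rewrite /= AZ cycle_subG.
  by have:= Z1y; rewrite inE => /andP[].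
- by rewrite AZ; apply: isog_cycle_Zp.
- by rewrite -(ker_commg_Z1 _ _ _ Z1y) groupP.
- by rewrite -(ker_commg_Z1 _ _ _ Z1y) ker_normal.
- rewrite -(ker_commg_Z1 _ _ _ Z1y) -/f.
  (* Since [f] maps [<[x]>] onto [<[z]>], the whole image, the preimage ['ker f * <[x]>] of that
     image is all of [G]. *)
  have Gker : G :=: 'ker f * <[x]>.
    rewrite -morphimK ?cycle_subG // morphim_cycle //= -def_z -def_fG.
    by rewrite morphimGK ?subsetIl.
  rewrite [X in X / _]Gker quotientMidl quotient_cycle //.
  exact: subsetP (ker_norm f) x Gx.
- rewrite -(ker_commg_Z1 _ _ _ Z1y).
  apply: isog_trans (first_isog f) _; rewrite def_fG.
  exact: isog_cycle_Zp.
(* [A] lies in [G0] because it is abelian and contains [y]; that it centralizes [G0] is checked on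
   the generators. *)
rewrite subsetI; apply/andP; split.
  apply/subsetP=> a Aa; rewrite inE (subsetP sAG) //=.
  by apply/commgP; apply: (centsP abA) => //; rewrite mem_gen // setU11.
rewrite gen_subG subUset sub1set; apply/andP; split.
  by apply/centP=> w; rewrite inE => /andP[_ /commgP/commute_sym].
rewrite (subset_trans (subsetIr _ _)) // centS //.
by apply/subsetP=> w; rewrite inE => /andP[].
Qed.
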